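(* Let $M$ be an oriented smooth $n$-dimensional manifold, possibly with smooth boundary, smoothly embedded as a compact subset of $\mathbb{R}^n$. For all $g,h\in\mathrm{Diff}_+(M)$, $$\theta_M(g\circ h)=J_M(h)^{-1}\,(\theta_M(g)\circ h)\,J_M(h)+\theta_M(h).$$
   Context: $\mathrm{Diff}_+(M)$ is the group of orientation-preserving $C^\infty$ self-diffeomorphisms of $M$. $J_M(g)=(\partial_{x_j}g_i)_{i,j}$ is the Jacobian matrix of $g$ in the standard coordinates of $\mathbb{R}^n$, and $\theta_M(g)=J_M(g)^{-1}dJ_M(g)$, a $\mathfrak{gl}(n,\mathbb{R})$-valued $1$-form on $M$. For a matrix-valued form $A$ and $f\in\mathrm{Diff}_+(M)$, $A\circ f$ denotes the pullback $f^*A$. *)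

(* Defs.v *)
From HB Require Import structures.
From mathcomp Require Import all_boot all_order all_algebra.
From mathcomp Require Import all_classical all_reals all_analysis.

Set Implicit Arguments.
Unset Strict Implicit.
Unset Printing Implicit Defensive.

Import Order.TTheory GRing.Theory Num.Theory.
Import numFieldNormedType.Exports.

Local Open Scope classical_set_scope.
Local Open Scope ring_scope.

(* Points and tangent vectors of R^n are column vectors, so that the matrix
   (d g_i / d x_j)_(i, j) acts on tangent vectors by left multiplication.
   Maps defined on a subset X of R^n are represented by total functions; every
   notion relative to X below only depends on their values on X. *)

Section SmoothMaps.
Context {R : realType} {n : nat} {W : normedModType R}.
Implicit Types (U X : set 'cV[R]_n) (f : 'cV[R]_n -> W).

(* C^k on an open set U. *)
Fixpoint Ck_open (k : nat) U f : Prop :=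
  match k with
  | 0 => forall x, U x -> {for x, continuous f}
  | k'.+1 => (forall x, U x -> differentiable f x) /\
      forall j : 'I_n, Ck_open k' U ('D_(delta_mx j 0) f)
  end.

Definition smooth_open U f : Prop := forall k, Ck_open k U f.

(* Smoothness on an arbitrary subset X: local extendability to smooth maps on
   open subsets of R^n, as usual for manifolds with boundary. *)
Definition smooth_on X f : Prop :=
  forall p, X p -> exists (U : set 'cV[R]_n) (F : 'cV[R]_n -> W),
    [/\ open U, U p, smooth_open U F & forall x, X x -> U x -> F x = f x].

(* Differential at x of the restriction of f to X: the linear map L such that
   f y = f x + L (y - x) + o(y - x) as y tends to x within X. At a point of a
   codimension-0 submanifold with boundary there is at most one such L, and it
   is the differential of any smooth local extension of f. *)
Definition diff_on X f (x : 'cV[R]_n) : 'cV[R]_n -> W :=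
  'd f (within X (nbhs x)).

End SmoothMaps.

Section Manifolds.
Context {R : realType} {n : nat}.
Implicit Types (M X Y : set 'cV[R]_n) (g h : 'cV[R]_n -> 'cV[R]_n).

Definition diffeomorphism X Y g : Prop :=
  exists g' : 'cV[R]_n -> 'cV[R]_n,
    [/\ smooth_on X g, smooth_on Y g',
        (forall x, X x -> Y (g x)) /\ (forall y, Y y -> X (g' y)),
        (forall x, X x -> g' (g x) = x) & (forall y, Y y -> g (g' y) = y)].

(* The half-space {y | y_0 >= 0}, which is the whole of R^0 if n = 0. *)
Definition half_space : set 'cV[R]_n :=
  [set y | forall i : 'I_n, val i = 0%N -> 0 <= y i 0].

(* Interior points of M are covered too, by charts whose image V lies inside
   the open half-space. *)
Definition submanifold_with_boundary M : Prop :=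
  forall p, M p -> exists (U V : set 'cV[R]_n) (phi : 'cV[R]_n -> 'cV[R]_n),
    [/\ open U, U p, open V, diffeomorphism U V phi
      & phi @` (M `&` U) = V `&` half_space].

Definition Jac M g (x : 'cV[R]_n) : 'M[R]_n :=
  \matrix_(i, j) diff_on M (fun y => g y i 0) x (delta_mx j 0).

(* An orientation of M is a continuous choice of orientation of the tangent
   spaces T_x M = R^n; o x = false stands for the standard orientation of R^n,
   and o x = true for the opposite one. *)
Definition orientation M (o : 'cV[R]_n -> bool) : Prop :=
  forall x, M x -> \forall y \near within M (nbhs x), o y = o x.

Definition orientation_preserving M (o : 'cV[R]_n -> bool) g : Prop :=
  forall x, M x -> 0 < (-1) ^+ o x * (-1) ^+ o (g x) * \det (Jac M g x).

Definition Diff_plus M (o : 'cV[R]_n -> bool) : set ('cV[R]_n -> 'cV[R]_n) :=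
  [set g | diffeomorphism M M g /\ orientation_preserving M o g].

(* omega x v is the value of the form omega at the point x on the tangent
   vector v. *)
Definition mxform1 := 'cV[R]_n -> 'cV[R]_n -> 'M[R]_n.

Definition pullback M g (omega : mxform1) : mxform1 :=
  fun x v => omega (g x) (diff_on M g x v).

Definition theta M g : mxform1 :=
  fun x v => invmx (Jac M g x) *m diff_on M (Jac M g) x v.

End Manifolds.

(* Main.v *)
(* Each map that is smooth on M agrees near a point of M with a map that is
   differentiable on an open set, so the identity reduces to the chain rule
   J(g o h) = (J(g) o h) J(h) and the product rule, provided that a differential
   within M does not depend on the extension. It does not: in a chart the
   directions pointing into the half-space span R^n, so a linear map L with
   L (y - p) = o(y - p) as y tends to p within M is zero. *)

From HB Require Import structures.
Require Import Defs.
From mathcomp Require Import all_boot all_order all_algebra.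
From mathcomp Require Import all_classical all_reals all_analysis.
Import Order.TTheory GRing.Theory Num.Theory.
Import numFieldNormedType.Exports.
Local Open Scope classical_set_scope.
Local Open Scope ring_scope.

Set Implicit Arguments.
Unset Strict Implicit.

(** * Uniqueness of differentials within a manifold with boundary *)

Section Tangent.
Context {R : realType} {n : nat}.

Lemma smooth_open_differentiable (W : normedModType R) (U : set 'cV[R]_n)
    (F : 'cV[R]_n -> W) x :
  smooth_open U F -> U x -> differentiable F x.
Proof. by move=> /(_ 1%N) [+ _] Ux; apply. Qed.

(** Differentiability depends only on the germ: the first-order expansion of [f] is also one of [g],
    and [diff_unique] identifies the differentials. *)
Lemma near_eq_differentiable (V W : normedModType R) (f g : V -> W) x :
  (\near x, f x = g x) -> differentiable f x ->
  differentiable g x /\ 'd g x = 'd f x :> (V -> W).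
Proof.
move=> fg df.
have fgx : f x = g x by exact: nbhs_singleton fg.
have dg : g \o shift x = cst (g x) + 'd f x +o_ 0 id.
  apply/eqaddoP => e e0.
  have /eqaddoP /(_ _ e0) := diff_locally df.
  apply: filter_app.
  have : \forall h \near 0, f (h + x) = g (h + x).
    by move: fg; rewrite (near_shift 0) subr0.
  by apply: filterS => h fgh; rewrite !fctE /= fgh fgx.
have dgE := diff_unique (diff_continuous df) dg.
split; last exact: dgE.
by apply/diff_locallyP; rewrite dgE; split; [exact: diff_continuous|exact: dg].
Qed.

Lemma smooth_on_open_differentiable (W : normedModType R) (U : set 'cV[R]_n)
    (f : 'cV[R]_n -> W) x :
  open U -> smooth_on U f -> U x -> differentiable f x.
Proof.
move=> oU sf Ux; have [V [F [oV Vx sF Ff]]] := sf x Ux.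
have dF := smooth_open_differentiable sF Vx.
apply: (proj1 (near_eq_differentiable _ dF)).
near=> y; apply: Ff; near: y; exact: open_nbhs_nbhs.
Unshelve. all: by end_near. Qed.

Lemma half_space_add_scale (q w : 'cV[R]_n) (t : R) :
  half_space q -> half_space w -> 0 <= t -> half_space (q + t *: w).
Proof.
by move=> hq hw t0 i i0; rewrite !mxE addr_ge0 ?mulr_ge0 ?hq ?hw.
Qed.

(** At most one coordinate is constrained, so its sign decides. This is how the inward directions
    are seen to span the whole space. *)
Lemma half_space_total (w : 'cV[R]_n) : half_space w \/ half_space (- w).
Proof.
have [Hn|/existsNP [i /not_implyP [i0 wi]]] := pselect (half_space w); first by left.
right=> j j0; have -> : j = i by apply/val_inj; rewrite /= j0 i0.
by rewrite mxE oppr_ge0; case/orP: (le_total 0 (w i 0)).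
Qed.

(** For [w] in the half-space, [psi (t *: w + q)] stays in [M] for small [t > 0] and leaves [p] with
    velocity ['d psi q w]; the bound along this curve forces [L] to vanish on that velocity. *)
Lemma tangent_unique (W : normedModType R) (M : set 'cV[R]_n) p
    (L : {linear 'cV[R]_n -> W}) :
  submanifold_with_boundary M -> M p -> continuous L ->
  (forall e : R, 0 < e ->
    \forall y \near p, M y -> `|L (y - p)| <= e * `|y - p|) ->
  forall v, L v = 0.
Proof.
move=> sM Mp cL Lo.
have [U [V [phi [oU Up oV]]]] := sM p Mp.
move=> [psi [sphi spsi [UV VU] phiK psiK]] imphi.
set q := phi p.
have Vq : V q by exact: UV.
have hq : half_space q.
  by have : (phi @` (M `&` U)) q by [exists p]; rewrite imphi => -[].
have psiq : psi q = p by exact: phiK.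
have dpsi : differentiable psi q.
  exact: smooth_on_open_differentiable spsi Vq.
have dphi : differentiable phi p.
  exact: smooth_on_open_differentiable sphi Up.
(* The chain rule for [psi \o phi], which is the identity near [p], makes ['d psi q] surjective. *)
have dK v : 'd psi q ('d phi p v) = v.
  have [_ dE] : differentiable (psi \o phi) p /\
      'd (psi \o phi) p = 'd id p :> ('cV[R]_n -> 'cV[R]_n).
    apply: near_eq_differentiable; last first.
      exact: (@ex_diff _ _ _ _ _ _ _ (is_diff_id p)).
    near=> y; apply/esym/phiK; near: y; exact: open_nbhs_nbhs.
  have /(congr1 (fun k => k v)) /= <- := diff_comp dphi dpsi.
  by rewrite dE (@diff_val _ _ _ _ _ _ _ (is_diff_id p)).
have Lhalf w : half_space w -> L ('d psi q w) = 0.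
  move=> hw; set c := 'd psi q w.
  pose r := fun t : R => t^-1 *: (psi (t *: w + q) - psi q).
  have rc : r t @[t --> 0^'+] --> c.
    (* The two-sided derivative is restricted to [t > 0], where [t *: w + q] remains in the
       half-space. *)
    apply: cvg_dnbhs_at_right; rewrite /c -deriveE //.
    exact: diff_derivable.
  have Lr : L (r t) @[t --> 0^'+] --> L c by apply: continuous_cvg rc; exact: cL.
  have cq : (t *: w + q) @[t --> (0:R)^'+] --> q.
    rewrite -[X in _ --> X]add0r -[X in X + q](scale0r w).
    apply: cvgD; last exact: cvg_cst.
    by apply: cvgZr_tmp; apply: cvg_at_right_filter; exact: cvg_id.
  have cpsi : psi (t *: w + q) @[t --> (0:R)^'+] --> p.
    rewrite -psiq; apply: continuous_cvg cq.
    exact: differentiable_continuous.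
  suff Le e : 0 < e -> `|L c| <= e * `|c|.
    apply/eqP; rewrite -normr_le0; apply/ler_addgt0Pr => e e0; rewrite add0r.
    (* The bound is used with [e / (|c| + 1)]; adding 1 avoids a division by zero when [c = 0]. *)
    have c1 : 0 < `|c| + 1 by rewrite ltr_pwDr.
    rewrite (le_trans (Le _ (divr_gt0 e0 c1)))//.
    by rewrite mulrAC ler_pdivrMr // ler_pM2l // lerDl.
  move=> e0.
  have nLr : `|L (r t)| @[t --> 0^'+] --> `|L c| by exact: cvg_norm Lr.
  have nr : e * `|r t| @[t --> 0^'+] --> e * `|c|.
    by apply: cvgMr; exact: cvg_norm rc.
  (* It suffices to prove the inequality for the difference quotients [r t], where it is the
     hypothesis on [L] scaled by [t^-1]. *)
  apply: (ler_cvg_to nLr nr).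
  near=> t.
  have t0 : 0 < t by near: t; exact: nbhs_right_gt.
  have Vt : V (t *: w + q).
    near: t; apply: cq; exact: open_nbhs_nbhs.
  have Mt : M (psi (t *: w + q)).
    have : (V `&` half_space) (t *: w + q).
      by split=> //; rewrite addrC; apply: half_space_add_scale => //; exact: ltW.
    by rewrite -imphi => -[z [Mz Uz] <-]; rewrite phiK.
  have : `|L (psi (t *: w + q) - p)| <= e * `|psi (t *: w + q) - p|.
    by move: Mt; near: t; apply: (cpsi _ (Lo e e0)).
  rewrite /r linearZ /= !normrZ psiq mulrCA.
  by rewrite ler_pM2l // normr_gt0 invr_neq0 // gt_eqF.
move=> v; have [|] := half_space_total ('d phi p v) => /Lhalf.
  by rewrite dK.
by rewrite linearN dK linearN => /eqP; rewrite oppr_eq0 => /eqP.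
Unshelve. all: by end_near. Qed.

(** [diff_on] selects by [get] some continuous linear map satisfying the expansion within [M]. The
    differential of [F] satisfies it too, and [tangent_unique] kills the difference. *)
Lemma diff_on_extension (W : normedModType R) (M : set 'cV[R]_n)
    (f F : 'cV[R]_n -> W) x :
  submanifold_with_boundary M -> M x -> differentiable F x ->
  (\forall y \near x, M y -> F y = f y) ->
  diff_on M f x = 'd F x.
Proof.
move=> sM Mx dF Ff.
have Fx : F x = f x by exact: (nbhs_singleton Ff).
have PF : ProperFilter (within M (nbhs x)).
  by apply: within_nbhs_proper; exact: subset_closure.
(* The differential along a filter takes the limit of the filter as its base point. *)
have limx : lim (within M (nbhs x)) = x.
  apply: (@cvg_lim _ _ _ (within M (nbhs x)) _ id) => //.
  exact: cvg_within.
rewrite /diff_on /diff.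
set P := (X in get X).
have P_littleo (df : {linear 'cV[R]_n -> W}) : P df <-> continuous df /\
    forall e : R, 0 < e ->
    \forall y \near x, M y -> `|f y - f x - df (y - x)| <= e * `|y - x|.
  rewrite /P limx; split=> -[cdf] H; split=> //.
    move=> e e0.
    have /eqaddoP /(_ _ e0) : f = (fun y => f x + df (y - x))
        +o_ (within M (nbhs x)) (fun y => y - x).
      by rewrite funeqE.
    apply: (@filterS _ (nbhs x)) => y /[apply].
    by rewrite !fctE opprD addrA.
  apply: eqaddoEx; apply/funeqP/eqaddoE/eqaddoP.
  move=> e e0; have := H e e0.
  apply: (@filterS _ (nbhs x)) => y /[apply].
  by rewrite !fctE opprD addrA.
have dFo (e : R) : 0 < e ->
    \forall y \near x, `|F y - F x - 'd F x (y - x)| <= e * `|y - x|.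
  move=> e0; have [_ /funeqP/eqaddoP/(_ _ e0)] := (proj1 (diffP _ _) dF).
  rewrite lim_id //; apply: (@filterS _ (nbhs x)) => y.
  by rewrite !fctE opprD addrA.
have PdF : P ('d F x).
  apply/P_littleo; split; first exact: diff_continuous.
  move=> e e0; move: (dFo e e0) Ff; apply: filterS2 => y He HF My.
  by rewrite -Fx -HF.
have Pget : P (get P) by apply: getPex; exists ('d F x).
have [cg go] := (P_littleo _).1 Pget.
have [cF Fo] := (P_littleo _).1 PdF.
rewrite funeqE => v; apply/subr0_eq.
pose D : {linear 'cV[R]_n -> W} := (get P : _ -> _) \- ('d F x : _ -> _).
apply: (@tangent_unique _ _ x D sM Mx) => [y|e e0].
  by apply: continuousB; [exact: cg|exact: cF].
have e2 : 0 < e / 2 by rewrite divr_gt0.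
move: (go _ e2) (Fo _ e2); apply: filterS2 => y Hg HF My.
(* Inserting [f y - f x] splits [D (y - x)] into the two remainders, each bounded with [e / 2]. *)
rewrite -[D _]/(get P (y - x) - 'd F x (y - x)).
rewrite -(subrKA (f y - f x)) [e]splitr mulrDl (le_trans (ler_normD _ _))//.
by apply: lerD; [rewrite distrC; exact: (Hg My)|exact: (HF My)].
Qed.

End Tangent.

(** * Entrywise calculus of matrix-valued maps and Jacobians *)

Section Jacobian.
Context {R : realType}.

Lemma diff_coord (V : normedModType R) m n (A : V -> 'M[R]_(m, n)) x i j :
  differentiable A x ->
  differentiable (fun y => A y i j) x /\
  forall v, 'd (fun y => A y i j) x v = 'd A x v i j.
Proof.
move=> dA.
have c_lin : linear (fun B : 'M[R]_(m, n) => B i j) by move=> a B C; rewrite !mxE.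
pose c : {linear 'M[R]_(m, n) -> R} :=
  HB.pack (fun B : 'M[R]_(m, n) => B i j) (GRing.isLinear.Build _ _ _ _ _ c_lin).
have cc : continuous c by exact: coord_continuous.
have dc := linear_differentiable (A x) cc.
split; first exact: (differentiable_comp dA dc).
move=> v; have /(congr1 (fun k => k v)) /= := diff_comp dA dc.
by rewrite (diff_lin (A x) cc).
Qed.

Lemma differentiable_mx (V : normedModType R) m n (A : V -> 'M[R]_(m, n)) x :
  (forall i j, differentiable (fun y => A y i j) x) -> differentiable A x.
Proof.
move=> dA.
have -> : A = \sum_i \sum_j (fun y => A y i j *: delta_mx i j).
  rewrite funeqE => y; rewrite [LHS]matrix_sum_delta !fct_sumE.
  by apply: eq_bigr => i _; rewrite fct_sumE.
apply: differentiable_sum => i; apply: differentiable_sum => j.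
exact: differentiableZl.
Qed.

(** Each entry of the product is a sum of products of real functions, to which the scalar Leibniz
    rule for directional derivatives applies. *)
Lemma diff_mulmx (V : normedModType R) m n p (A : V -> 'M[R]_(m, n))
    (B : V -> 'M[R]_(n, p)) x :
  differentiable A x -> differentiable B x ->
  differentiable (fun y => A y *m B y) x /\
  forall v, 'd (fun y => A y *m B y) x v = 'd A x v *m B x + A x *m 'd B x v.
Proof.
move=> dA dB.
have dAe i j := (diff_coord i j dA).1.
have dBe i j := (diff_coord i j dB).1.
have DA i j v : 'D_v (fun y => A y i j) x = 'd A x v i j.
  by rewrite (deriveE v (dAe i j)) (diff_coord i j dA).2.
have DB i j v : 'D_v (fun y => B y i j) x = 'd B x v i j.
  by rewrite (deriveE v (dBe i j)) (diff_coord i j dB).2.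
have entryE i j : (fun y => (A y *m B y) i j) =
    \sum_k ((fun y => A y i k) * (fun y => B y k j)).
  by rewrite funeqE => y; rewrite mxE fct_sumE.
have dAB : differentiable (fun y => A y *m B y) x.
  apply: differentiable_mx => i j; rewrite entryE.
  by apply: differentiable_sum => k; exact: differentiableM.
split=> // v; apply/matrixP => i j.
rewrite -(diff_coord i j dAB).2 -deriveE; last first.
  exact: (diff_coord i j dAB).1.
rewrite entryE derive_sum; last first.
  by move=> k; apply: diff_derivable; exact: differentiableM.
rewrite !mxE -big_split; apply: eq_bigr => k _ /=.
rewrite deriveM; [|exact: diff_derivable|exact: diff_derivable].
by rewrite DA DB addrC; congr (_ + _); exact: mulrC.
Qed.

(** The counterpart of [Jac] for extensions: it uses full neighbourhoods, so the ordinary chain rule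
    applies to it. *)
Definition jacmx {m n} (F : 'cV[R]_n -> 'cV[R]_m) (x : 'cV[R]_n) : 'M[R]_(m, n) :=
  \matrix_(i, j) 'D_(delta_mx j 0) F x i 0.

Lemma jacmx_mul m n (F : 'cV[R]_n -> 'cV[R]_m) x v :
  differentiable F x -> 'd F x v = jacmx F x *m v.
Proof.
move=> dF; rewrite {1}(matrix_sum_delta v) linear_sum.
apply/matrixP => i j; rewrite summxE !mxE (ord1 j); apply: eq_bigr => k _.
by rewrite big_ord1 linearZ !mxE deriveE // mulrC.
Qed.

Lemma jacmx_unique m n (F : 'cV[R]_n -> 'cV[R]_m) x (A : 'M[R]_(m, n)) :
  differentiable F x -> (forall v, 'd F x v = A *m v) -> jacmx F x = A.
Proof.
move=> dF dFE; apply/matrixP => i j.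
by rewrite mxE deriveE // dFE -colE mxE.
Qed.

Lemma jacmx_comp m n p (F : 'cV[R]_m -> 'cV[R]_n) (G : 'cV[R]_n -> 'cV[R]_p) x :
  differentiable F x -> differentiable G (F x) ->
  jacmx (G \o F) x = jacmx G (F x) *m jacmx F x.
Proof.
move=> dF dG; apply: jacmx_unique; first exact: differentiable_comp.
move=> v; have -> := diff_comp dF dG.
by rewrite /= !jacmx_mul // mulmxA.
Qed.

End Jacobian.

(** * Jacobians within [M] computed from local extensions *)

Section Extension.
Context {R : realType} {n : nat} {M : set 'cV[R]_n}
  (M_manifold : submanifold_with_boundary M).

Lemma Jac_extension (g G : 'cV[R]_n -> 'cV[R]_n) x :
  M x -> differentiable G x -> (\forall y \near x, M y -> G y = g y) ->
  Jac M g x = jacmx G x.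
Proof.
move=> Mx dG Gg; apply/matrixP => i j.
have [dGi dGiE] := diff_coord i 0 dG.
rewrite !mxE (diff_on_extension M_manifold Mx dGi); last first.
  by apply: filterS Gg => y /[apply] ->.
by rewrite dGiE deriveE.
Qed.

(** A single [G] serves at all points near [x]: differentiating [Jac M g] requires it to agree with
    [jacmx G] on [M] near [x], not just at [x]. *)
Lemma smooth_on_extension (g : 'cV[R]_n -> 'cV[R]_n) x :
  smooth_on M g -> M x -> exists G : 'cV[R]_n -> 'cV[R]_n,
    \forall y \near x, [/\ differentiable G y, differentiable (jacmx G) y
      & M y -> G y = g y /\ Jac M g y = jacmx G y].
Proof.
move=> sg Mx; have [U [G [oU Ux sG Gg]]] := sg x Mx; exists G.
near=> y.
have Uy : U y by near: y; exact: open_nbhs_nbhs.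
have dG : differentiable G y by exact: smooth_open_differentiable sG Uy.
split=> // [|My].
  apply: differentiable_mx => i j.
  have dDG : differentiable ('D_(delta_mx j 0) G) y.
    (* Order 2 is what makes the first partial derivatives differentiable. *)
    by have [_ /(_ j) [+ _]] := sG 2%N; apply.
  have -> : (fun z => jacmx G z i j) = (fun z => 'D_(delta_mx j 0) G z i 0).
    by rewrite funeqE => z; rewrite mxE.
  exact: (diff_coord i 0 dDG).1.
split; first exact: Gg.
apply: Jac_extension => //.
near=> z => Mz; apply: Gg => //; near: z; exact: open_nbhs_nbhs.
Unshelve. all: by end_near. Qed.

End Extension.

Lemma invmx_mul (R : fieldType) n (A B : 'M[R]_n) :
  A \in unitmx -> B \in unitmx -> invmx (A *m B) = invmx B *m invmx A.
Proof.
move=> uA uB; have uAB : A *m B \in unitmx by rewrite unitmx_mul uA.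
apply: (can_inj (mulKmx uAB)).
by rewrite mulmxV // mulmxA -(mulmxA A) mulmxV // mulmx1 mulmxV.
Qed.

(** The pointwise algebra of the identity: [A] and [B] stand for the Jacobians of [g] at [h x] and
    of [h] at [x], [X] and [Y] for their derivatives. *)
Lemma invmx_mul_product_rule (R : fieldType) n (A B X Y : 'M[R]_n) :
  A \in unitmx -> B \in unitmx ->
  invmx (A *m B) *m (X *m B + A *m Y) =
    invmx B *m (invmx A *m X) *m B + invmx B *m Y.
Proof.
move=> uA uB; rewrite invmx_mul // mulmxDr !mulmxA; congr (_ + _).
by rewrite -(mulmxA (invmx B)) mulVmx // mulmx1.
Qed.

Lemma orientation_preserving_unitmx (R : realType) n (M : set 'cV[R]_n) o g x :
  orientation_preserving M o g -> M x -> Jac M g x \in unitmx.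
Proof.
move=> og Mx; rewrite unitmxE unitfE.
by have := og x Mx; apply: contraTneq => ->; rewrite mulr0 ltxx.
Qed.

(** * The cocycle identity for [theta] *)

Theorem lemma4p3 (R : realType) (n : nat) (M : set 'cV[R]_n)
    (o : 'cV[R]_n -> bool)
    (M_compact : compact M)
    (M_manifold : submanifold_with_boundary M)
    (M_oriented : orientation M o)
    (g h : 'cV[R]_n -> 'cV[R]_n)
    (g_diff : Diff_plus M o g)
    (h_diff : Diff_plus M o h)
    (x : 'cV[R]_n) (x_in_M : M x) (v : 'cV[R]_n) :
  theta M (g \o h) x v =
    invmx (Jac M h x) *m pullback M h (theta M g) x v *m Jac M h x
    + theta M h x v.
Proof.
have [[g' [sg _ [gM _] _ _]] og] := g_diff.
have [[h' [sh _ [hM _] _ _]] oh] := h_diff.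
have Mhx : M (h x) by exact: hM.
have ug := orientation_preserving_unitmx og Mhx.
have uh := orientation_preserving_unitmx oh x_in_M.
have [G nG] := smooth_on_extension M_manifold sg Mhx.
have [H nH] := smooth_on_extension M_manifold sh x_in_M.
have [dG dJG /(_ Mhx) [Ghx JGhx]] := nbhs_singleton nG.
have [dH dJH /(_ x_in_M) [Hx JHx]] := nbhs_singleton nH.
have nGH : \forall y \near x, [/\ differentiable G (H y),
      differentiable (jacmx G) (H y) & M (H y) ->
      G (H y) = g (H y) /\ Jac M g (H y) = jacmx G (H y)].
  have cH : H @ x --> h x by rewrite -Hx; exact: differentiable_continuous.
  exact: cH nG.
have ext_gh : \forall y \near x, M y -> (G \o H) y = (g \o h) y.
  move: nGH nH; apply: filterS2 => y [_ _ Gy] [_ _ Hy] My /=.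
  (* [G] agrees with [g] only on [M], so [H y = h y] is needed first to place [H y] in [M]. *)
  have [Hhy _] := Hy My; rewrite -Hhy.
  by have [|-> _] := Gy; rewrite Hhy; [exact: hM|].
have Jgh : \forall y \near x, M y ->
    jacmx G (H y) *m jacmx H y = Jac M (g \o h) y.
  (* [Jac_extension] at [y] needs agreement on a whole neighbourhood of [y]; [near_join] provides it
     for all [y] near [x]. *)
  move/near_join: ext_gh; move: nGH nH; apply: filterS3.
  move=> y [dGHy _ _] [dHy _ _] ext_y My.
  rewrite -(jacmx_comp dHy dGHy).
  apply/esym/(Jac_extension M_manifold My _ ext_y).
  exact: (differentiable_comp dHy dGHy).
have Jghx : Jac M (g \o h) x = Jac M g (h x) *m Jac M h x.
  by rewrite -(nbhs_singleton Jgh) // Hx JGhx JHx.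
have dhE : diff_on M h x = 'd H x.
  apply: (diff_on_extension M_manifold x_in_M dH).
  by apply: filterS nH => y [_ _] /[apply] -[].
have dJgE : diff_on M (Jac M g) (h x) = 'd (jacmx G) (h x).
  apply: (diff_on_extension M_manifold Mhx dJG).
  by apply: filterS nG => y [_ _] /[apply] -[].
have dJhE : diff_on M (Jac M h) x = 'd (jacmx H) x.
  apply: (diff_on_extension M_manifold x_in_M dJH).
  by apply: filterS nH => y [_ _] /[apply] -[].
have dJG' : differentiable (jacmx G) (H x) by rewrite Hx.
have [dP dPE] := diff_mulmx (differentiable_comp dH dJG') dJH.
(* By [Jgh], the product of [jacmx G \o H] and [jacmx H] extends [Jac M (g \o h)] near [x]. Its
   product rule, with the chain rule on the first factor, produces the pulled-back tangent
   vector. *)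
have dJghE : diff_on M (Jac M (g \o h)) x v =
    diff_on M (Jac M g) (h x) (diff_on M h x v) *m Jac M h x +
    Jac M g (h x) *m diff_on M (Jac M h) x v.
  have extE := congr1 (fun k => k v)
    (diff_on_extension M_manifold x_in_M dP Jgh).
  have compE := congr1 (fun k => k v) (diff_comp dH dJG').
  apply: (etrans extE); apply: (etrans (dPE v)).
  apply: (etrans (congr1 (fun B => B *m _ + _) compE)).
  by rewrite dhE dJgE dJhE JHx JGhx -Hx.
rewrite /theta /pullback.
apply: (etrans (congr2 (fun P D => invmx P *m D) Jghx dJghE)).
exact (invmx_mul_product_rule _ _ ug uh).
Qed.
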